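(* For every integer $t\ge 1$, let $m=\binom{4t}{2}$ and $n=4t$. Then $$z_L(m,n)\;\ge\;2\binom{4t}{2}+4t^2-2t .$$ Consequently, $$\operatorname{BSR}(m,n)\;\ge\;2\binom{4t}{2}+4t^2-2t .$$ Moreover, for large $t$, $$\frac{z_L(m,n)-z(m,n)}{z(m,n)}\;\ge\;\frac{4t^2-2t}{16t^2-4t}=\frac{2t-1}{2(4t-1)},$$ where the right-hand side tends to $\frac14$ as $t\to\infty$.
   Context: **Classical Zarankiewicz number.** For $m\ge n\ge 2$, $z(m,n)$ is the maximum number of edges in a bipartite graph with parts $S=[m]=\{1,\dots,m\}$ and $T=[n]=\{1,\dots,n\}$ that contains no $K_{2,2}$ (equivalently, no cycle $C_4$). **Limited augmented bipartite graphs.** Let $G_1=(S,T,E_1)$ with $S=[m]$, $T=[n]$ be a $C_4$-free bipartite graph with $|E_1|=z(m,n)$. A limited augmented bipartite graph $G=(S,T,E_1\cup E_2)$ augmented from $G_1$ consists of the set $E_1$ of 1-edges (pairs, or ''cells'', $(i,j)\in S\times T$) and a set $E_2$ of 2-edges. A 2-edge is a quadruple $(i,j;k,l)$ with $i,k\in S$, $j,l\in T$, where the case $i=k$ and $j=l$ is forbidden; it is regarded as an unordered pair of the two distinct cells $(i,j)$ and $(k,l)$, called its halves. It is nondegenerate if $i\ne k$ and $j\ne l$, row-degenerate if $i=k$ and $j\neq l$, and column-degenerate if $i\ne k$ and $j=l$. The simplicity condition is imposed: no 2-edge shares a cell with any 1-edge or with another 2-edge. **Generalized $C_4$-cycles.**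 A cell $(i,j)$ is occupied if $(i,j)\in E_1$ or $(i,j)$ is a half of some 2-edge in $E_2$. The graph $G$ contains a generalized $C_4$-cycle if any of the following holds: 1. There is a classical $C_4$-cycle formed by 1-edges. 2. There is a nondegenerate 2-edge $(i,j;k,l)\in E_2$ such that both cells $(i,l)$ and $(k,j)$ are occupied. 3. There are a 2-edge $(i,j;p,q)\in E_2$ (of any type) and a cell $(k,l)$ with $k\notin\{i,p\}$ and $l\notin\{j,q\}$ such that the five cells $(k,l),(k,j),(k,q),(i,l),(p,l)$ are all occupied; if the 2-edge is nondegenerate, these five cells must moreover be pairwise distinct. **Limited augmented Zarankiewicz number.** $z_L(m,n)$ is the maximum of $|E_1|+|E_2|$ over all $m\times n$ limited augmented bipartite graphs $G=(S,T,E_1\cup E_2)$ (augmented from a $C_4$-free graph with $|E_1|=z(m,n)$, satisfying the simplicity condition) that contain no generalized $C_4$-cycle. **SOS rank.** An $m\times n$ biquadratic form is a real polynomial $P(\mathbf x,\mathbf y)=\sum_{i,k=1}^m\sum_{j,l=1}^n a_{ijkl}x_ix_ky_jy_l$ with $\mathbf x=(x_1,\dots,x_m)$, $\mathbf y=(y_1,\dots,y_n)$. It is SOS if $P=\sum_{p=1}^r f_p(\mathbf x,\mathbf y)^2$ for some bilinear forms $f_p$; the smallest such $r$ is the SOS rank of $P$. $\operatorname{BSR}(m,n)$ is the maximum SOS rank over all $m\times n$ SOS biquadratic forms. *)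

(* Defs.v *)
From mathcomp Require Import all_boot all_order all_algebra.
From mathcomp Require Import boolp classical_sets reals.
From mathcomp Require Import mpoly.

Set Implicit Arguments.
Unset Strict Implicit.
Unset Printing Implicit Defensive.

Import GRing.Theory.

Section BipartiteGraphs.

Variables m n : nat.

Notation cell := ('I_m * 'I_n)%type.

(* A bipartite graph with parts 'I_m and 'I_n is its set of edges (cells). *)
Definition has_C4 (E : {set cell}) : bool :=
  [exists i : 'I_m, exists k : 'I_m, exists j : 'I_n, exists l : 'I_n,
    [&& i != k, j != l,
        (i, j) \in E, (i, l) \in E, (k, j) \in E & (k, l) \in E]].

Definition zarankiewicz : nat :=
  \max_(E : {set cell} | ~~ has_C4 E) #|E|.

(* In [limited_augmented E1 E2] and below, a 2-edge (i,j;k,l) is the unordered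
   pair [set (i, j); (k, l)] of its two halves, which are distinct cells. *)
Definition limited_augmented (E1 : {set cell}) (E2 : {set {set cell}}) : bool :=
  [&& ~~ has_C4 E1, #|E1| == zarankiewicz,
      [forall e in E2, #|e| == 2],
      [forall e in E2, [disjoint e & E1]] &
      [forall e in E2, forall e' in E2, (e != e') ==> [disjoint e & e']]].

Definition occupied (E1 : {set cell}) (E2 : {set {set cell}}) (c : cell) : bool :=
  (c \in E1) || [exists e in E2, c \in e].

Definition has_generalized_C4 (E1 : {set cell}) (E2 : {set {set cell}}) : bool :=
  [|| has_C4 E1,
      [exists i : 'I_m, exists k : 'I_m, exists j : 'I_n, exists l : 'I_n,
        [&& i != k, j != l, [set (i, j); (k, l)] \in E2,
            occupied E1 E2 (i, l) & occupied E1 E2 (k, j)]] |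
      [exists i : 'I_m, exists p : 'I_m, exists j : 'I_n, exists q : 'I_n,
       exists k : 'I_m, exists l : 'I_n,
        let five := [:: (k, l); (k, j); (k, q); (i, l); (p, l)] in
        [&& [set (i, j); (p, q)] \in E2,
            k \notin [:: i; p], l \notin [:: j; q],
            all (occupied E1 E2) five &
            (i != p) && (j != q) ==> uniq five]]].

Definition limited_zarankiewicz : nat :=
  \max_(G : {set cell} * {set {set cell}} |
        limited_augmented G.1 G.2 && ~~ has_generalized_C4 G.1 G.2)
    (#|G.1| + #|G.2|).

End BipartiteGraphs.

Local Open Scope ring_scope.

Section BiquadraticForms.

Variables (R : realType) (m n : nat).

(* The variables x_1..x_m, y_1..y_n are the m + n variables of the polynomial
   ring, the x_i coming first. *)
Definition xvar (i : 'I_m) : {mpoly R[m + n]} := 'X_(lshift n i).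
Definition yvar (j : 'I_n) : {mpoly R[m + n]} := 'X_(rshift m j).

Definition biquadratic (P : {mpoly R[m + n]}) : Prop :=
  exists a : 'I_m -> 'I_n -> 'I_m -> 'I_n -> R,
    P = \sum_(i < m) \sum_(k < m) \sum_(j < n) \sum_(l < n)
          a i j k l *: (xvar i * xvar k * yvar j * yvar l).

Definition bilinear (f : {mpoly R[m + n]}) : Prop :=
  exists b : 'I_m -> 'I_n -> R,
    f = \sum_(i < m) \sum_(j < n) b i j *: (xvar i * yvar j).

Definition sum_of_squares (r : nat) (P : {mpoly R[m + n]}) : Prop :=
  exists f : 'I_r -> {mpoly R[m + n]},
    (forall p, bilinear (f p)) /\ P = \sum_(p < r) f p ^+ 2.

Definition is_sos (P : {mpoly R[m + n]}) : Prop :=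
  exists r, sum_of_squares r P.

(* The least r such that P is a sum of r squares; 0 if P is not SOS. *)
Definition sos_rank (P : {mpoly R[m + n]}) : nat :=
  xget 0%N [set r | sum_of_squares r P /\
                    forall s, sum_of_squares s P -> (r <= s)%N].

(* The maximum, attained, of the SOS ranks; the default value 0 would be used
   only if there were no maximum. *)
Definition BSR : nat :=
  xget 0%N [set b | (exists P, [/\ biquadratic P, is_sos P & sos_rank P = b]) /\
                    forall P, biquadratic P -> is_sos P -> (sos_rank P <= b)%N].

End BiquadraticForms.

Arguments BSR R m n : clear implicits.

(* Main.v *)
Require Import Defs.
From mathcomp Require Import all_boot all_order all_algebra.
From mathcomp Require Import boolp classical_sets reals topology normedtype sequences.
From mathcomp Require Import -(notations) mpoly.
From mathcomp Require Import ring lra zify.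

Import Order.TTheory GRing.Theory Num.Theory numFieldNormedType.Exports.

Set Implicit Arguments.
Unset Strict Implicit.

(** Take the 2N vertices (h, s) with h < N and s a bit, grouped in N partner
    pairs, and let the rows be all the 2-sets of vertices.  The incidence graph
    of vertices and 2-sets is C4-free, and it has twice as many edges as rows.
    This is extremal ([zarankiewicz_le]): in a C4-free graph each 2-set of
    columns is contained in at most one row, so the number of edges is at most
    the number of rows plus the number of 2-sets of columns.

    To augment it, take for two vertices x and y of equal bit and lying in
    distinct partner pairs, with x in the lower pair, the two rows {x, y} and
    {x, y'}, where ' denotes the partner.  Give the first row the extra column
    y' and the second one the extra column x', and join these two extra cells
    into a 2-edge.  There are 2 C(N, 2) such 2-edges, which is 4t^2 - 2t for
    N = 2t.  Every row now occupies its own 2-set, or a triple made of a partner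
    pair and one vertex of another pair, and the 2-edge above has the triples
    {x, y, y'} and {x, y', x'}.  The cell of row {x, y} and column x' is empty, so
    the 2-edge closes no rectangle; and a star over this 2-edge would need
    a column common to the two triples, hence x, and another row that
    occupies x, x' and y'.  As the lower pair of such a row would be that of x,
    the rule for the extra column forces this row to be {x, y'}, one of the two
    rows of the 2-edge: [row_of_partner_pairs].

    The bound on the SOS rank holds for every admissible augmented graph G
    ([limited_zarankiewicz_le_BSR]).  Let P_G be the sum of the squares of
    x_i y_j over the 1-edges and of x_i y_j + x_k y_l over the 2-edges.  If P_G is
    a sum of s squares, let b(c) in R^s collect the coefficients of the cell c
    in the s bilinear forms.  Comparing coefficients determines
      <b(i,j), b(k,l)> + <b(i,l), b(k,j)>
    for all i, j, k, l ([gram_cross]).  The absence of generalized C4-cycles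
    makes both terms separately determined ([gramE]): cells in
    distinct edges have orthogonal vectors, and each occupied cell has a unit
    vector.  One cell per edge gives |E1| + |E2| orthonormal vectors in R^s,
    so s is at least |E1| + |E2|.  The maximum defining BSR exists since a sum
    of more than mn squares of bilinear forms can always be shortened
    ([sum_of_squares_drop]). *)

(** * The extremal number of a C4-free bipartite graph *)

(** A row with d columns contains C(d, 2) >= d - 1 pairs of columns, and no pair
    of columns is contained in two rows; sum the inequality over the rows. *)
Lemma zarankiewicz_le (m n : nat) : zarankiewicz m n <= m + 'C(n, 2).
Proof.
apply/bigmax_leqP => E noC4.
pose N (i : 'I_m) : {set 'I_n} := [set j | (i, j) \in E].
have -> : #|E| = \sum_(i < m) #|N i|.
  rewrite -sum1_card (eq_bigl (fun c => (c.1, c.2) \in E)); last by case.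
  rewrite -(pair_big_dep predT (fun i j => (i, j) \in E) (fun _ _ => 1)) /=.
  by apply: eq_bigr => i _; rewrite -sum1_card; apply: eq_bigl => j; rewrite inE.
pose D := [set A : {set 'I_n} | #|A| == 2].
have -> : 'C(n, 2) = #|D| by rewrite card_draws card_ord.
have le_row (i : 'I_m) : #|N i| <= 1 + \sum_(A in D) (A \subset N i).
  have -> : \sum_(A in D) (A \subset N i) = 'C(#|N i|, 2).
    rewrite -cards_draws -sum1_card big_mkcond [RHS]big_mkcond /=.
    by apply: eq_bigr => A _; rewrite !inE; case: (#|A| == 2); case: (A \subset _).
  by case: #|N i| => [|[|k]] //; rewrite binS bin1; lia.
apply: (leq_trans (leq_sum _ (fun i _ => le_row i))).
rewrite big_split /= sum1_card card_ord leq_add2l exchange_big /= -sum1_card.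
apply: leq_sum => A; rewrite inE => /cards2P[j [l [jl ->]]].
have -> : \sum_(i < m) ([set j; l] \subset N i) = #|[set i | [set j; l] \subset N i]|.
  by rewrite -sum1dep_card [RHS]big_mkcond; apply: eq_bigr => i _; case: (_ \subset _).
rewrite leqNgt; apply/negP => /card_gt1P[i [k]] [].
rewrite !inE !finset.subUset !finset.sub1set !inE => /andP[ij il] /andP[kj kl] ik.
case/negP: noC4; apply/existsP; exists i; apply/existsP; exists k.
by apply/existsP; exists j; apply/existsP; exists l; rewrite ik jl ij il kj.
Qed.

(** * The augmented incidence graph *)

Section Construction.

Variable N : nat.

Notation vertex := ('I_N * bool)%type.
Implicit Types (u v w x y : vertex) (e : {set vertex}).

Definition partner v : vertex := (v.1, ~~ v.2).

(** The extra column of the row {x, y}, where x lies in the lower of two distinct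
    partner pairs: it completes the pair of y if x and y have the same bit, and
    that of x otherwise.  Thus the two rows through x that meet the pair of y
    complete different pairs. *)
Definition extra x y : vertex := if x.2 == y.2 then partner y else partner x.

Lemma cross_pair_inj x y u w : x.1 < y.1 -> u.1 < w.1 ->
  [set x; y] = [set u; w] -> x = u /\ y = w.
Proof.
move=> xy uw xyuw; have := set21 x y; have := set22 x y; rewrite xyuw !inE.
move=> /orP[]/eqP yE /orP[]/eqP xE; move: xy uw; rewrite xE yE ?ltnn //.
by move=> wu /(ltn_trans wu); rewrite ltnn.
Qed.

Lemma extra_notin x y : x.1 < y.1 -> extra x y \notin [set x; y].
Proof.
case: x y => h s [g r] /= hg; rewrite !inE /extra /partner /=.
by case: s r => [] [] /=; rewrite !xpair_eqE -!val_eqE /=; lia.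
Qed.

(** This empty cell is a corner of the rectangle spanned by a 2-edge; it
    excludes the rectangle configuration of a generalized C4-cycle. *)
Lemma partner_notin_row x y : x.1 < y.1 -> x.2 = y.2 ->
  partner x \notin [set x; y; extra x y].
Proof.
case: x y => h s [g r] /= hg <-; rewrite !inE /extra /partner eqxx /=.
by case: s; rewrite !xpair_eqE -!val_eqE /=; lia.
Qed.

(** The triples {x, y, y'} and {x, y', x'} of the two rows of a 2-edge meet in x and
    y' only, so a star over the 2-edge, whose column avoids those of the two
    halves, sits in column x. *)
Lemma common_point x y v : x.1 < y.1 -> x.2 = y.2 -> v != partner y ->
  v \in [set x; y; extra x y] -> v \in [set x; partner y; extra x (partner y)] -> v = x.
Proof.
case: x y v => h s [g r] [k q] /= hg <-; rewrite !inE /extra /partner eqxx /=.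
move=> vy vxy vxpy; apply/eqP; move: vy vxy vxpy.
by case: s q => [] []; rewrite /= !xpair_eqE -!val_eqE /=; lia.
Qed.

(** A triple containing x, x' and y' with x in the lower pair consists of the
    lower pair and one vertex of the upper pair.  The row {u, w} carrying it
    completes its lower pair, so its bits differ: u = x and w = y'. *)
Lemma row_of_partner_pairs x y u w : x.1 < y.1 -> x.2 = y.2 -> u.1 < w.1 ->
  x \in [set u; w; extra u w] -> partner x \in [set u; w; extra u w] ->
  partner y \in [set u; w; extra u w] -> u = x /\ w = partner y.
Proof.
case: x y u w => h s [h' s'] [g r] [g' r'] /= hh' <- gg'.
rewrite !inE /extra /partner /= => xr pxr pyr.
suff : ((g, r) == (h, s)) && ((g', r') == (h', ~~ s)) by move=> /andP[/eqP-> /eqP->].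
move: hh' gg' xr pxr pyr.
by case: s r r' => [] [] []; rewrite /= !xpair_eqE -!val_eqE /=; lia.
Qed.

Variables (m n : nat) (rowset : 'I_m -> {set vertex}) (row : {set vertex} -> 'I_m).
Variables (label : 'I_n -> vertex) (col : vertex -> 'I_n).
Hypothesis card_rowset : forall i, #|rowset i| = 2.
Hypothesis rowsetK : cancel rowset row.
Hypothesis rowK : forall e, #|e| = 2 -> rowset (row e) = e.
Hypothesis labelK : cancel label col.
Hypothesis colK : cancel col label.

Definition incidence : {set 'I_m * 'I_n} := [set c | label c.2 \in rowset c.1].

Definition extra_cell x y : 'I_m * 'I_n := (row [set x; y], col (extra x y)).

Definition cross_pairs : {set vertex * vertex} :=
  [set q : vertex * vertex | (q.1.1 < q.2.1) && (q.1.2 == q.2.2)].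

Definition two_edge (q : vertex * vertex) : {set 'I_m * 'I_n} :=
  [set extra_cell q.1 q.2; extra_cell q.1 (partner q.2)].

Definition two_edges : {set {set 'I_m * 'I_n}} := [set two_edge q | q in cross_pairs].

Lemma rowset_cross x y : x.1 < y.1 -> rowset (row [set x; y]) = [set x; y].
Proof.
move=> xy; apply: rowK; rewrite cards2; case: eqVneq => // xyE.
by rewrite xyE ltnn in xy.
Qed.

Lemma extra_cell_inj x y u w : x.1 < y.1 -> u.1 < w.1 ->
  extra_cell x y = extra_cell u w -> x = u /\ y = w.
Proof.
move=> xy uw [/(congr1 rowset) + _]; rewrite !rowset_cross //.
exact: cross_pair_inj.
Qed.

Lemma partner_neq v : partner v != v.
Proof. by case: v => h []; rewrite xpair_eqE andbF. Qed.

(** A cell of a 2-edge remembers the edge: its row gives the two pairs and the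
    vertex x, and the bits of the row tell which half it is.  Hence the 2-edges
    are pairwise disjoint and as many as their index pairs. *)
Lemma two_edge_meet q q' c : q \in cross_pairs -> q' \in cross_pairs ->
  c \in two_edge q -> c \in two_edge q' -> q = q'.
Proof.
case: q q' => x y [u w]; rewrite !inE /= => /andP[xy /eqP xyE] /andP[uw /eqP uwE].
have clash v v' : v.2 = v'.2 -> v.2 = (partner v').2 -> False.
  by rewrite /= => ->; case: v'.2.
case/orP=> /eqP-> /orP[]/eqP/extra_cell_inj[] // xu yw; subst x.
- by subst y.
- by case: (clash u w) => //; rewrite xyE yw.
- by case: (clash u y) => //; rewrite uwE -yw.
by move: (congr1 partner yw); rewrite /partner /= !negbK -!surjective_pairing => ->.
Qed.

Lemma two_edge_inj : {in cross_pairs &, injective two_edge}.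
Proof.
move=> q q' qP q'P qq'.
by apply: (two_edge_meet (c := extra_cell q.1 q.2) qP q'P); rewrite -?qq' set21.
Qed.

(** Two rows {x, y} and {x, y'} make up one 2-edge, so all rows across two partner
    pairs receive exactly one extra cell, irrespective of the bits. *)
Lemma occupied_cases c : occupied incidence two_edges c ->
  label c.2 \in rowset c.1 \/ exists x y, x.1 < y.1 /\ c = extra_cell x y.
Proof.
case/orP=> [|/exists_inP[_ /imsetP[[x y] + ->]]]; first by rewrite inE; left.
rewrite !inE /= => /andP[xy _] /orP[]/eqP->; right.
  by exists x, y.
by exists x, (partner y).
Qed.

Lemma occupied_cross_row x y j : x.1 < y.1 ->
  occupied incidence two_edges (row [set x; y], j) ->
  label j \in [set x; y; extra x y].
Proof.
move=> xy /occupied_cases[/=|[u [w [uw [/(congr1 rowset) + ->]]]]].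
  by rewrite rowset_cross // => jxy; rewrite finset.in_setU jxy.
rewrite !rowset_cross // => /(cross_pair_inj xy uw)[-> ->].
by rewrite colK !inE eqxx !orbT.
Qed.

Lemma incidence_C4_free : ~~ has_C4 incidence.
Proof.
apply/negP => /existsP[i /existsP[k /existsP[j /existsP[l]]]].
rewrite !inE /= => /and5P[/negP ik jl ij il /andP[kj kl]]; apply: ik.
have row_of i' : label j \in rowset i' -> label l \in rowset i' ->
    rowset i' = [set label j; label l].
  move=> i'j i'l; apply/esym/eqP; rewrite eqEcard finset.subUset !finset.sub1set i'j i'l /=.
  by rewrite card_rowset cards2 (inj_eq (can_inj labelK)) jl.
apply/eqP/(can_inj rowsetK).
by rewrite (row_of i ij il) (row_of k kj kl).
Qed.

Lemma card_incidence : #|incidence| = 2 * m.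
Proof.
rewrite -sum1_card (eq_bigl (fun c => label c.2 \in rowset c.1)); last first.
  by move=> c; rewrite inE.
rewrite -(pair_big_dep predT (fun i j => label j \in rowset i) (fun _ _ => 1)) /=.
rewrite (eq_bigr (fun _ => 2)) => [|i _]; first by rewrite sum_nat_const card_ord mulnC.
rewrite -(card_rowset i) -sum1_card [RHS](reindex label) //.
by exists col => ? _; rewrite ?labelK ?colK.
Qed.

Lemma card_two_edges : 2 * 'C(N, 2) <= #|two_edges|.
Proof.
rewrite (card_in_imset two_edge_inj).
pose D := [set p : 'I_N * 'I_N | p.1 < p.2].
have <- : #|D| = 'C(N, 2).
  rewrite -sum1_card (eq_bigl (fun p : 'I_N * 'I_N => p.1 < p.2)) => [|p]; last by rewrite inE.
  rewrite -(pair_big_dep predT (fun i j : 'I_N => i < j) (fun _ _ => 1)) /=.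
  rewrite (exchange_big_dep predT) //= -bin2_sum big_mkord; apply: eq_bigr => j _.
  by rewrite -(big_ord_widen N (fun _ => 1) (ltnW (ltn_ord j))) sum1_card card_ord.
rewrite mulnC -card_bool -cardsT -cardsX.
pose f (p : 'I_N * 'I_N * bool) : vertex * vertex := ((p.1.1, p.2), (p.1.2, p.2)).
rewrite -(card_imset _ (f := f)) => [|[[h g] s] [[h' g'] s'] [-> -> ->]] //.
apply: subset_leq_card; apply/fintype.subsetP => _ /imsetP[p pD ->].
by move: pD; rewrite !inE /= => /andP[-> _]; rewrite eqxx.
Qed.

Lemma two_edges_augment : m = 'C(n, 2) -> limited_augmented incidence two_edges.
Proof.
move=> mE; apply/and5P; split.
- exact: incidence_C4_free.
- rewrite eqn_leq; apply/andP; split; last first.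
    by rewrite card_incidence (leq_trans (zarankiewicz_le m n)) // mul2n -addnn -mE.
  apply: (@leq_bigmax_cond _ (fun E => ~~ has_C4 E) (fun E => #|E|)).
  exact: incidence_C4_free.
- apply/forall_inP => _ /imsetP[[x y] + ->]; rewrite !inE /= => /andP[xy _].
  rewrite cards2; case: (eqVneq (extra_cell _ _)) => // E.
  have [_ yE] := @extra_cell_inj x y x (partner y) xy xy E.
  by have := partner_neq y; rewrite -yE eqxx.
- apply/forall_inP => _ /imsetP[[x y] + ->]; rewrite !inE /= => /andP[xy _].
  rewrite finset.disjoints_subset finset.subUset !finset.sub1set !inE /= !colK.
  by rewrite !rowset_cross // !extra_notin.
apply/forall_inP => _ /imsetP[q qP ->]; apply/forall_inP => _ /imsetP[q' q'P ->].
apply/implyP => neq; rewrite -finset.setI_eq0; apply: contra_neqT neq => /finset.set0Pn[c].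
by rewrite finset.inE => /andP[cq cq']; rewrite (two_edge_meet qP q'P cq cq').
Qed.

Lemma extra_partner x y : x.2 = y.2 -> extra x (partner y) = partner x.
Proof. by rewrite /extra => -> /=; case: (y.2). Qed.

Lemma extra_same x y : x.2 = y.2 -> extra x y = partner y.
Proof. by rewrite /extra => ->; rewrite eqxx. Qed.

(** The star configuration would put its centre in a row with columns x, x' and y',
    other than the two rows of the 2-edge.  A row has only two columns of its
    own, so one of the three is its extra column and the row joins two distinct
    partner pairs. *)
Lemma full_cross_row x y k : x.1 < y.1 -> x.2 = y.2 ->
  occupied incidence two_edges (k, col x) ->
  occupied incidence two_edges (k, col (partner x)) ->
  occupied incidence two_edges (k, col (partner y)) ->
  k = row [set x; partner y].
Proof.
move=> xy xyE kx kpx kpy.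
have cross u w : u.1 < w.1 -> k = row [set u; w] -> k = row [set x; partner y].
  move=> uw kE; move: kx kpx kpy; rewrite kE.
  move=> /(occupied_cross_row uw) uwx /(occupied_cross_row uw) uwpx.
  move=> /(occupied_cross_row uw) uwpy; rewrite !colK in uwx uwpx uwpy.
  by have [-> ->] := row_of_partner_pairs xy xyE uw uwx uwpx uwpy.
have [kx'|[u [w [uw [kE _]]]]] := occupied_cases kx; last exact: cross kE.
have [kpx'|[u [w [uw [kE _]]]]] := occupied_cases kpx; last exact: cross kE.
have [kpy'|[u [w [uw [kE _]]]]] := occupied_cases kpy; last exact: cross kE.
move: kx' kpx' kpy'; rewrite /= !colK => kx' kpx' kpy'.
have /subset_leq_card : [set x; partner x; partner y] \subset rowset k.
  by rewrite !finset.subUset !finset.sub1set kx' kpx' kpy'.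
rewrite card_rowset -!finset.setUA !cardsU1 cards1 !inE.
have -> : (x == partner x) = false by rewrite eq_sym (negPf (partner_neq x)).
have -> : (x == partner y) = false.
  by apply/eqP => E; rewrite E /= ltnn in xy.
have -> // : (partner x == partner y) = false.
by apply/eqP => /(congr1 fst)/= E; rewrite E ltnn in xy.
Qed.

Lemma two_edgesP c d : [set c; d] \in two_edges -> exists x y, [/\ x.1 < y.1, x.2 = y.2 &
  (c = extra_cell x y /\ d = extra_cell x (partner y)) \/
  (d = extra_cell x y /\ c = extra_cell x (partner y))].
Proof.
case/imsetP=> -[x y]; rewrite inE /= => /andP[xy /eqP xyE] cdE.
exists x, y; split=> //.
have : c \in two_edge (x, y) by rewrite -cdE set21.
have : d \in two_edge (x, y) by rewrite -cdE set22.
have : extra_cell x y \in [set c; d] by rewrite cdE set21.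
have : extra_cell x (partner y) \in [set c; d] by rewrite cdE set22.
rewrite !inE /= => /orP[]/eqP <- /orP[]/eqP -> /orP[]/eqP ? /orP[]/eqP ?; subst; auto.
Qed.

Lemma two_edges_generalized_C4_free : ~~ has_generalized_C4 incidence two_edges.
Proof.
rewrite /has_generalized_C4 !negb_or incidence_C4_free /=; apply/andP; split.
  apply/negP => /existsP[i /existsP[k /existsP[j /existsP[l]]]].
  case/and5P=> _ _ /two_edgesP[x [y [xy xyE ends]]] il kj.
  (* The corner of the rectangle in row {x, y} is the column of the other half. *)
  suff occ : occupied incidence two_edges (row [set x; y], col (partner x)).
    have := partner_notin_row xy xyE; rewrite -[partner x]colK.
    by rewrite occupied_cross_row.
  rewrite -(extra_partner xyE).
  by case: ends => [[[iE jE] [kE lE]]|[[kE lE] [iE jE]]]; rewrite -?iE -?lE -?kE -?jE.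
apply/negP => /existsP[i /existsP[p /existsP[j /existsP[q /existsP[k /existsP[l]]]]]].
case/and5P=> /two_edgesP[x [y [xy xyE ends]]] kip ljq /and5P[kl kj kq il /andP[pl _]] _.
(* The star configuration is symmetric in the two halves of the 2-edge. *)
wlog {ends} [[iE jE] [pE qE]] : i p j q kip ljq kj kq il pl /
    (i, j) = extra_cell x y /\ (p, q) = extra_cell x (partner y).
  move=> IH; case: ends => [|[pq ij]]; first exact: IH.
  apply: (IH p i q j) => //.
    by move: kip; rewrite !inE orbC.
  by move: ljq; rewrite !inE orbC.
have {qE} qE : q = col (partner x) by rewrite qE extra_partner.
have {jE} jE : j = col (partner y) by rewrite jE extra_same.
subst i p j q; move: kip ljq; rewrite !inE !negb_or => /andP[_ kp] /andP[lj _].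
have lx : l = col x.
  rewrite -[l]labelK (@common_point x y (label l)) //.
  - by apply: contraNneq lj => <-; rewrite labelK.
  - exact: occupied_cross_row.
  exact: occupied_cross_row.
by subst l; case/negP: kp; apply/eqP/full_cross_row.
Qed.

End Construction.

Lemma exists_ordinal_bij (T : finType) (n : nat) : #|T| = n ->
  exists (f : 'I_n -> T) (g : T -> 'I_n), cancel f g /\ cancel g f.
Proof. by move=> <-; exists enum_val, enum_rank; split; [exact: enum_valK | exact: enum_rankK]. Qed.

(** The construction lives on 2-sets and labelled vertices; enumerating both turns
    it into a graph on ordinals. *)
Lemma exists_augmented_graph (N : nat) : 0 < N ->
  exists (E1 : {set 'I_('C(N * 2, 2)) * 'I_(N * 2)}) (E2 : {set {set _}}),
    [/\ limited_augmented E1 E2, ~~ has_generalized_C4 E1 E2,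
        #|E1| = 2 * 'C(N * 2, 2) & 2 * 'C(N, 2) <= #|E2|].
Proof.
move=> N0; have cardV : #|{: 'I_N * bool}| = N * 2 by rewrite card_prod card_ord card_bool.
have [label [col [labelK colK]]] := exists_ordinal_bij cardV.
pose pair_type := {e : {set 'I_N * bool} | #|e| == 2}.
have card_pairs : #|{: pair_type}| = 'C(N * 2, 2).
  by rewrite card_sig -cardV -card_draws; apply: eq_card => e; rewrite !inE.
have [pair [row [pairK rowK]]] := exists_ordinal_bij card_pairs.
(* A row is needed as the default value off the 2-sets. *)
have m0 : 0 < 'C(N * 2, 2) by rewrite bin_gt0; lia.
pose rowset i := val (pair i).
pose row_of_set (e : {set 'I_N * bool}) := row (insubd (pair (Ordinal m0)) e).
have card_rowset i : #|rowset i| = 2 by exact/eqP/(valP (pair i)).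
have rowsetK : cancel rowset row_of_set by move=> i; rewrite /row_of_set valKd pairK.
have row_of_setK (e : {set 'I_N * bool}) : #|e| = 2 -> rowset (row_of_set e) = e.
  by move=> e2; rewrite /rowset /row_of_set rowK insubdK // unfold_in e2.
exists (incidence rowset label), (two_edges row_of_set col); split.
- exact: (two_edges_augment card_rowset rowsetK row_of_setK labelK colK erefl).
- exact: (two_edges_generalized_C4_free card_rowset rowsetK row_of_setK labelK colK).
- exact: (card_incidence card_rowset labelK colK).
exact: (card_two_edges col row_of_setK).
Qed.

Lemma zarankiewicz_bin2 (N : nat) : 0 < N ->
  zarankiewicz 'C(N * 2, 2) (N * 2) = 2 * 'C(N * 2, 2).
Proof.
by move=> /exists_augmented_graph[E1 [E2 [/and5P[_ /eqP <- _ _ _] _ ->]]].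
Qed.

Lemma limited_zarankiewicz_ge (N : nat) : 0 < N ->
  2 * 'C(N * 2, 2) + 2 * 'C(N, 2) <= limited_zarankiewicz 'C(N * 2, 2) (N * 2).
Proof.
move=> /exists_augmented_graph[E1 [E2 [augG freeG <- card2]]].
have max_le : #|E1| + #|E2| <= limited_zarankiewicz 'C(N * 2, 2) (N * 2).
  apply: (@leq_bigmax_cond _ (fun G => limited_augmented G.1 G.2 &&
    ~~ has_generalized_C4 G.1 G.2) (fun G => #|G.1| + #|G.2|) (E1, E2)).
  by rewrite augG.
by apply: leq_trans max_le; rewrite leq_add2l.
Qed.

Local Open Scope ring_scope.


(** * Existence of the maximal SOS rank *)

Section SumsOfSquares.

Variables (R : realType) (m n : nat).

Notation form := (mpoly (m + n) R).

Definition bilinear_form (b : 'I_m -> 'I_n -> R) : form :=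
  \sum_(i < m) \sum_(j < n) b i j *: (xvar R n i * yvar R m j).

Lemma bilinearD (f g : form) : Defs.bilinear f -> Defs.bilinear g -> Defs.bilinear (f + g).
Proof.
move=> [b ->] [c ->]; exists (fun i j => b i j + c i j).
by rewrite -big_split; apply: eq_bigr => i _; rewrite -big_split; apply: eq_bigr => j _;
   rewrite scalerDl.
Qed.

Lemma bilinearZ (a : R) (f : form) : Defs.bilinear f -> Defs.bilinear (a *: f).
Proof.
move=> [b ->]; exists (fun i j => a * b i j).
by rewrite scaler_sumr; apply: eq_bigr => i _; rewrite scaler_sumr; apply: eq_bigr => j _;
   rewrite scalerA.
Qed.

Lemma sum_of_squares_biquadratic (r : nat) (P : form) :
  sum_of_squares r P -> biquadratic P.
Proof.
move=> [f [/choice[b fE] ->]]; exists (fun i j k l => \sum_(p < r) b p i j * b p k l).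
have sq p : f p ^+ 2 = \sum_(i < m) \sum_(k < m) \sum_(j < n) \sum_(l < n)
    (b p i j * b p k l) *: (xvar R n i * xvar R n k * yvar R m j * yvar R m l).
  rewrite expr2 {1 2}fE mulr_suml; apply: eq_bigr => i _; rewrite mulr_sumr.
  apply: eq_bigr => k _; rewrite mulr_suml; apply: eq_bigr => j _; rewrite mulr_sumr.
  apply: eq_bigr => l _; rewrite -scalerAl -scalerAr scalerA; congr (_ *: _).
  by rewrite -!mulrA; congr (_ * _); rewrite mulrCA.
rewrite (eq_bigr _ (fun p _ => sq p)) exchange_big; apply: eq_bigr => i _.
rewrite exchange_big; apply: eq_bigr => k _; rewrite exchange_big; apply: eq_bigr => j _.
by rewrite exchange_big; apply: eq_bigr => l _; rewrite scaler_suml.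
Qed.

(** Spreading g over the f q as f q + la (a q) g, the cross terms sum to
    2 la g^2, because the sum of the (a q) (f q) is g, and the squares to
    la^2 A g^2, with A the sum of the (a q)^2.  It suffices that
    2 la + A la^2 = 1, whose positive root is 1 / (1 + sqrt (1 + A)). *)
Lemma sum_of_squares_absorb (r : nat) (f : 'I_r -> form) (g : form) (a : 'I_r -> R) :
  (forall q, Defs.bilinear (f q)) -> Defs.bilinear g -> g = \sum_(q < r) a q *: f q ->
  sum_of_squares r (g ^+ 2 + \sum_(q < r) f q ^+ 2).
Proof.
move=> fB gB gE; pose A := \sum_(q < r) a q ^+ 2.
have A0 : 0 <= A by apply: sumr_ge0 => q _; exact: sqr_ge0.
pose s := Num.sqrt (1 + A).
have s2 : s ^+ 2 = 1 + A by rewrite sqr_sqrtr //; lra.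
have s0 : 0 <= s by exact: sqrtr_ge0.
(* This form of the root of A la^2 + 2 la = 1 is valid for A = 0 as well. *)
pose la := (1 + s)^-1.
have laE : la *+ 2 + la ^+ 2 * A = 1.
  have -> : A = s ^+ 2 - 1 by rewrite s2; ring.
  by rewrite /la; field; rewrite gt_eqF //; lra.
exists (fun q => f q + (la * a q) *: g); split=> [q|].
  by apply: bilinearD => //; exact: bilinearZ.
have -> : \sum_(q < r) (f q + (la * a q) *: g) ^+ 2
    = \sum_(q < r) f q ^+ 2 + (la *: \sum_(q < r) a q *: f q) * g *+ 2
      + (la ^+ 2 * A) *: g ^+ 2.
  rewrite scaler_sumr mulr_suml -sumrMnl mulr_sumr scaler_suml -!big_split /=.
  apply: eq_bigr => q _; rewrite sqrrD; congr (_ + _ + _).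
    by rewrite -scalerAr scalerA -scalerAl.
  by rewrite exprZn exprMn.
rewrite -gE -scalerAl -expr2 -scaler_nat scalerA -addrA -scalerDl.
by rewrite mulr_natl laE scale1r addrC.
Qed.

(** More than mn bilinear forms are linearly dependent, so one of them is
    a combination of the others and can be absorbed. *)
Lemma sum_of_squares_drop (r : nat) (P : form) :
  (m * n < r.+1)%N -> sum_of_squares r.+1 P -> sum_of_squares r P.
Proof.
move=> lt_r [f [fB ->]]; have /choice[b fE] := fB.
pose B : 'M[R]_(r.+1, m * n) := \matrix_(p < r.+1) mxvec (\matrix_(i, j) b p i j).
have : kermx B != 0.
  rewrite kermx_eq0 /row_free; apply: contraTneq lt_r => <-.
  by rewrite -leqNgt rank_leq_col.
case/rowV0Pn => c /sub_kermxP cB; case/rV0Pn => p0 c0.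
have rel i j : \sum_(p < r.+1) c 0 p * b p i j = 0.
  have /matrixP/(_ 0 (mxvec_index i j)) := cB; rewrite !mxE => rel.
  by rewrite -[RHS]rel; apply: eq_bigr => p _; rewrite mxE mxvecE mxE.
have dep : \sum_(p < r.+1) c 0 p *: f p = 0.
  under eq_bigr => p _ do rewrite fE scaler_sumr.
  rewrite exchange_big big1 // => i _; under eq_bigr => p _ do rewrite scaler_sumr.
  rewrite exchange_big big1 // => j _; under eq_bigr => p _ do rewrite scalerA.
  by rewrite -scaler_suml rel scale0r.
rewrite (bigD1_ord p0) //=.
apply: (@sum_of_squares_absorb _ _ _ (fun q => - (c 0 (lift p0 q) / c 0 p0))) => //.
move: dep; rewrite (bigD1_ord p0) //= => /eqP; rewrite addr_eq0 => /eqP dep.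
rewrite -[LHS](scalerK c0) dep scalerN scaler_sumr -sumrN; apply: eq_bigr => q _.
by rewrite scalerA scaleNr mulrC.
Qed.

Lemma sum_of_squares_bound (r : nat) (P : form) :
  sum_of_squares r P -> exists2 s, (s <= m * n)%N & sum_of_squares s P.
Proof.
elim: r => [|r IHr] sosP; first by exists 0%N.
have [le_r|lt_r] := leqP r.+1 (m * n); first by exists r.+1.
exact/IHr/sum_of_squares_drop.
Qed.

Lemma sos_rankP (P : form) : is_sos P ->
  sum_of_squares (sos_rank P) P /\
  forall s, sum_of_squares s P -> (sos_rank P <= s)%N.
Proof.
move=> [r sosP]; pose rank := [set r | sum_of_squares r P /\
  forall s, sum_of_squares s P -> (r <= s)%N]%classic.
suff : rank (xget 0%N rank) by [].
apply: xgetPex; have exP : exists r, `[< sum_of_squares r P >] by exists r; exact/asboolP.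
exists (ex_minn exP); case: ex_minnP => k /asboolP sosk kmin.
by split=> // s soss; apply: kmin; exact/asboolP.
Qed.

Lemma sos_rank_le_BSR (P : form) : is_sos P -> (sos_rank P <= BSR R m n)%N.
Proof.
move=> sosP.
pose attained r := exists Q : form, [/\ biquadratic Q, is_sos Q & sos_rank Q = r].
pose maxi := [set b | attained b /\
  forall Q : form, biquadratic Q -> is_sos Q -> (sos_rank Q <= b)%N]%classic.
suff [_] : maxi (xget 0%N maxi).
  by apply=> //; case: sosP => r /sum_of_squares_biquadratic.
apply: xgetPex.
have ex : exists r, `[< attained r >].
  exists (sos_rank P); apply/asboolP; exists P; split=> //.
  by case: sosP => r /sum_of_squares_biquadratic.
have ub r : `[< attained r >] -> (r <= m * n)%N.
  move=> /asboolP[Q [_ sosQ <-]]; have [_ Qmin] := sos_rankP sosQ.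
  case: sosQ => s /sum_of_squares_bound[s' les' /Qmin le_rank].
  exact: leq_trans les'.
exists (ex_maxn ex ub); case: ex_maxnP => b /asboolP attb bmax.
by split=> // Q biQ sosQ; apply: bmax; apply/asboolP; exists Q.
Qed.

End SumsOfSquares.

(** * Coefficients of a sum of squares of bilinear forms *)

Section Polarization.

Variables (R : realType) (m n : nat).

Notation form := (mpoly (m + n) R).

(** The point x = e_i + s e_k, y = e_j + s' e_l, in the concatenated
    coordinates. *)
Definition two_term_point (i k : 'I_m) (j l : 'I_n) (s s' : R) (z : 'I_(m + n)) : R :=
  match split z with
  | inl a => (a == i)%:R + s * (a == k)%:R
  | inr b => (b == j)%:R + s' * (b == l)%:R
  end.

Lemma sum_two_deltas (I : finType) (F : I -> R) (i k : I) (s : R) :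
  \sum_a F a * ((a == i)%:R + s * (a == k)%:R) = F i + s * F k.
Proof.
under eq_bigr => a _ do rewrite mulrDr mulrCA.
rewrite big_split -mulr_sumr /=.
have delta x : \sum_a F a * (a == x)%:R = F x.
  by rewrite (bigD1 x) //= eqxx mulr1 big1 ?addr0 // => a /negPf->; rewrite mulr0.
by rewrite !delta.
Qed.

Lemma meval_bilinear_form (b : 'I_m -> 'I_n -> R) i k j l s s' :
  meval (two_term_point i k j l s s') (bilinear_form b)
  = (b i j + s' * b i l) + s * (b k j + s' * b k l).
Proof.
rewrite -(sum_two_deltas (fun a => b a j + s' * b a l)) rmorph_sum.
apply: eq_bigr => a _; rewrite -(sum_two_deltas (b a)) rmorph_sum mulr_suml.
apply: eq_bigr => d _; rewrite /= mevalZ mevalM !mevalXU /two_term_point.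
by rewrite (unsplitK (inl a)) (unsplitK (inr d)); ring.
Qed.

(** A second difference equal, on biquadratic forms, to half the coefficient at
    x_i x_k y_j y_l, doubled for each of the coincidences i = k and j = l.  With
    these factors one formula covers all index patterns. *)
Definition cross_coeff (P : form) (i k : 'I_m) (j l : 'I_n) : R :=
  let val s s' := meval (two_term_point i k j l s s') P in
  (val 1 1 - val (-1) 1 - val 1 (-1) + val (-1) (-1)) / 8.

(** With p, q, r, t the coefficients of a form at (i,j), (i,l), (k,j), (k,l), this
    is the identity
    (p+q+r+t)^2 - (p+q-r-t)^2 - (p-q+r-t)^2 + (p-q-r+t)^2 = 8 (pt + qr). *)
Lemma cross_coeff_sos (I : finType) (A : pred I) (b : I -> 'I_m -> 'I_n -> R) i k j l :
  cross_coeff (\sum_(p | A p) bilinear_form (b p) ^+ 2) i k j l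
  = \sum_(p | A p) (b p i j * b p k l + b p i l * b p k j).
Proof.
rewrite /cross_coeff !rmorph_sum -!sumrB -big_split mulr_suml.
by apply: eq_bigr => p _; rewrite !rmorphXn /= !meval_bilinear_form; field.
Qed.

End Polarization.

(** * Augmented graphs as partitions of the occupied cells *)

Section AugmentedGraph.

Variables (m n : nat) (E1 : {set 'I_m * 'I_n}) (E2 : {set {set 'I_m * 'I_n}}).
Hypothesis augG : limited_augmented E1 E2.
Hypothesis freeG : ~~ has_generalized_C4 E1 E2.

Notation cell := ('I_m * 'I_n)%type.
Implicit Types (c d : cell) (e f : {set cell}).

(** Turning each 1-edge into a singleton makes an augmented graph a family of
    disjoint blocks of cells, each of which contributes one square to P_G. *)
Definition blocks : {set {set cell}} := [set [set c] | c in E1] :|: E2.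

Definition same_block c d := [exists e in blocks, (c \in e) && (d \in e)].

Lemma same_blockC c d : same_block c d = same_block d c.
Proof. by apply: eq_existsb => e; rewrite [(c \in e) && _]andbC. Qed.

Lemma card_two_edge e : e \in E2 -> #|e| = 2%N.
Proof. by case/and5P: augG => _ _ /'forall_implyP h _ _ /h /eqP. Qed.

Lemma block_unique e f c : e \in blocks -> f \in blocks -> c \in e -> c \in f -> e = f.
Proof.
case/and5P: augG => _ _ _ /'forall_implyP disj1 /'forall_implyP disj2.
have disj e' d : e' \in E2 -> d \in E1 -> d \in e' -> False.
  by move=> /disj1 e'E1 dE1 /(disjointFr e'E1); rewrite dE1.
move=> /setUP[/imsetP[d dE1 ->]|eE2] /setUP[/imsetP[d' d'E1 ->]|fE2].
- by rewrite !inE => /eqP-> /eqP->.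
- by rewrite inE => /eqP-> /(disj _ _ fE2 dE1).
- by move=> ce; rewrite inE => /eqP cd'; case: (disj _ _ eE2 d'E1); rewrite -cd'.
move=> ce cf; apply/eqP; apply: contraTT (disj2 e eE2) => ef.
rewrite negb_forall_in; apply/exists_inP; exists f => //; rewrite ef /=.
by apply: contraL cf => /disjointFr /(_ ce) ->.
Qed.

Lemma occupied_same_block c : occupied E1 E2 c = same_block c c.
Proof.
apply/idP/idP => [/orP[cE1|/exists_inP[e eE2 ce]]|/exists_inP[e]].
- by apply/exists_inP; exists [set c]; rewrite !inE ?eqxx // imset_f.
- by apply/exists_inP; exists e; rewrite ?ce // inE eE2 orbT.
rewrite andbb => /setUP[/imsetP[d dE1 ->]|eE2] ce; rewrite /occupied.
  by move: ce; rewrite inE => /eqP->; rewrite dE1.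
by apply/orP; right; apply/exists_inP; exists e.
Qed.

Lemma same_block_occupied c d : same_block c d -> occupied E1 E2 c.
Proof.
rewrite occupied_same_block => /exists_inP[e eB /andP[ce _]].
by apply/exists_inP; exists e; rewrite ?ce.
Qed.

Lemma same_block_two_edge c d : same_block c d -> c != d -> [set c; d] \in E2.
Proof.
move=> /exists_inP[e /setUP[/imsetP[x _ ->]|eE2] /andP[ce de]] cd.
  by move: ce de cd; rewrite !inE => /eqP-> /eqP->; rewrite eqxx.
suff -> : [set c; d] = e by [].
by apply/eqP; rewrite eqEcard finset.subUset !finset.sub1set ce de card_two_edge // cards2 cd.
Qed.

Lemma occupied_two_edge c : occupied E1 E2 c -> c \notin E1 ->
  exists2 d, c != d & same_block c d.
Proof.
case/orP=> [->//|/exists_inP[e eE2 ce] _].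
have : (0 < #|e :\ c|)%N by rewrite -(ltn_add2l (c \in e)) -cardsD1 card_two_edge // ce.
case/card_gt0P => d; rewrite !inE => /andP[dc de]; exists d; first by rewrite eq_sym.
by apply/exists_inP; exists e; rewrite ?ce // inE eE2 orbT.
Qed.

Lemma card_blocks : #|blocks| = (#|E1| + #|E2|)%N.
Proof.
rewrite cardsU card_imset; last exact: set1_inj.
suff -> : [set [set c] | c in E1] :&: E2 = finset.set0 by rewrite cards0 subn0.
apply/setP => e; rewrite !inE; apply/negP => /andP[/imsetP[c _ ->] /card_two_edge].
by rewrite cards1.
Qed.

(** The blocks are disjoint, so at most one term is nonzero.  This sum is the
    Gram matrix of the defining decomposition of P_G. *)
Lemma sum_same_block (S : pzRingType) c d :
  \sum_(e in blocks) ((c \in e)%:R * (d \in e)%:R : S) = (same_block c d)%:R.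
Proof.
have [/exists_inP[e eB /andP[ce de]]|no_e] := boolP (same_block c d).
  rewrite (bigD1 e) //= ce de mulr1 big1 ?addr0 // => f /andP[fB fe].
  have [cf|_] := boolP (c \in f); last by rewrite mul0r.
  by rewrite (block_unique fB eB cf ce) eqxx in fe.
rewrite big1 // => e eB; rewrite -natrM mulnb (_ : _ && _ = false) //.
by apply: contraNF no_e => cde; apply/exists_inP; exists e.
Qed.

Lemma no_one_edge_C4 i k j l : i != k -> j != l ->
  [|| (i, j) \notin E1, (k, l) \notin E1, (i, l) \notin E1 | (k, j) \notin E1].
Proof.
move=> ik jl; apply: contraNT freeG; rewrite !negb_or !negbK => /and4P[ij kl il kj].
apply/orP; left; apply/existsP; exists i; apply/existsP; exists k.
by apply/existsP; exists j; apply/existsP; exists l; rewrite ik jl ij il kj.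
Qed.

Lemma open_diagonal i k j l : i != k -> j != l -> same_block (i, j) (k, l) ->
  ~~ (occupied E1 E2 (i, l) && occupied E1 E2 (k, j)).
Proof.
move=> ik jl ijkl; apply/negP => /andP[il kj].
have e2 := same_block_two_edge ijkl; rewrite xpair_eqE negb_and ik in e2.
case/negP: freeG; rewrite /has_generalized_C4; apply/or3P; apply: Or32.
apply/existsP; exists i; apply/existsP; exists k.
by apply/existsP; exists j; apply/existsP; exists l; rewrite ik jl e2 // il.
Qed.

Lemma open_star i p j q k l :
  same_block (i, j) (p, q) -> (i, j) != (p, q) -> k \notin [:: i; p] -> l \notin [:: j; q] ->
  ~~ all (occupied E1 E2) [:: (k, l); (k, j); (k, q); (i, l); (p, l)].
Proof.
move=> /same_block_two_edge e2 /e2 {}e2 kip ljq; apply/negP => occ.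
case/negP: freeG; rewrite /has_generalized_C4; apply/or3P; apply: Or33.
apply/existsP; exists i; apply/existsP; exists p; apply/existsP; exists j.
apply/existsP; exists q; apply/existsP; exists k; apply/existsP; exists l.
apply/and5P; split=> //; apply/implyP => /andP[ip jq].
move: kip ljq; rewrite !inE !negb_or => /andP[ki kp] /andP[lj lq].
by rewrite /= !inE !xpair_eqE !negb_or !negb_and ki kp lj lq ip jq !orbT.
Qed.

End AugmentedGraph.

(** * Rigidity of the Gram matrix *)

Section GramMatrix.

Variables (R : realType) (m n : nat).
Variables (E1 : {set 'I_m * 'I_n}) (E2 : {set {set 'I_m * 'I_n}}).
Hypothesis augG : limited_augmented E1 E2.
Hypothesis freeG : ~~ has_generalized_C4 E1 E2.

Notation cell := ('I_m * 'I_n)%type.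
Notation occ := (occupied E1 E2).
Notation same := (same_block E1 E2).

Definition block_poly : mpoly (m + n) R :=
  \sum_(e in blocks E1 E2) bilinear_form (fun i j => ((i, j) \in e)%:R : R) ^+ 2.

Variables (s : nat) (b : 'I_s -> 'I_m -> 'I_n -> R).
Hypothesis bE : block_poly = \sum_(p < s) bilinear_form (b p) ^+ 2.

Definition gram (c d : cell) : R := \sum_(p < s) b p c.1 c.2 * b p d.1 d.2.

Lemma gramC c d : gram c d = gram d c.
Proof. by apply: eq_bigr => p _; rewrite mulrC. Qed.

(** Both sides are the same mixed coefficient of P_G, computed from two
    decompositions into squares. *)
Lemma gram_cross i j k l :
  gram (i, j) (k, l) + gram (i, l) (k, j)
  = (same (i, j) (k, l))%:R + (same (i, l) (k, j))%:R.
Proof.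
rewrite -!(sum_same_block augG) -!big_split /=.
rewrite -(cross_coeff_sos predT b) -(cross_coeff_sos (fun e => e \in blocks E1 E2)
  (fun (e : {set cell}) i j => ((i, j) \in e)%:R : R)).
by rewrite -bE.
Qed.

Lemma gram_row i j l : gram (i, j) (i, l) = (same (i, j) (i, l))%:R.
Proof.
have := gram_cross i j i l; rewrite (gramC (i, l)) (same_blockC _ _ (i, l)).
by lra.
Qed.

Lemma gram_col i k j : gram (i, j) (k, j) = (same (i, j) (k, j))%:R.
Proof. by have := gram_cross i j k j; lra. Qed.

Lemma gram_diag c : gram c c = (occ c)%:R.
Proof. by case: c => i j; rewrite gram_row occupied_same_block. Qed.

(** The squared norm of the coefficient vector of c is the coefficient of P_G at
    the square of the monomial of c, which is 0 if c is not occupied. *)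
Lemma coeff_unoccupied c p : ~~ occ c -> b p c.1 c.2 = 0.
Proof.
move=> Nocc; have := gram_diag c; rewrite (negPf Nocc) => /eqP.
rewrite psumr_eq0 => [|q _]; last by rewrite -expr2 sqr_ge0.
by move=> /allP/(_ p (mem_index_enum p)); rewrite /= mulf_eq0 orbb => /eqP.
Qed.

Lemma gram_unoccupied c d : ~~ occ c -> gram c d = 0.
Proof. by move=> Nocc; rewrite /gram big1 // => p _; rewrite coeff_unoccupied // mul0r. Qed.

(** If the opposite diagonal has an unoccupied cell, it contributes nothing to
    [gram_cross], which then determines the other diagonal. *)
Lemma gram_open i j k l : ~~ (occ (i, l) && occ (k, j)) ->
  gram (i, j) (k, l) = (same (i, j) (k, l))%:R.
Proof.
move=> Nocc; have := gram_cross i j k l.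
have -> : gram (i, l) (k, j) = 0.
  by case/nandP: Nocc => Nocc; last rewrite gramC; exact: gram_unoccupied.
have -> : same (i, l) (k, j) = false.
  apply: contraNF Nocc => sb; rewrite (same_block_occupied sb).
  by rewrite same_blockC in sb; rewrite (same_block_occupied sb).
by rewrite !addr0.
Qed.

Lemma gram_same c d : same c d -> gram c d = 1.
Proof.
case: c d => i j [k l] sb; have [ik|ik] := eqVneq i k.
  by subst k; rewrite gram_row sb.
have [jl|jl] := eqVneq j l; first by subst l; rewrite gram_col sb.
by rewrite gram_open ?sb // open_diagonal.
Qed.

(** Two unit vectors of inner product 1 are equal. *)
Lemma coeff_same c d p : same c d -> b p c.1 c.2 = b p d.1 d.2.
Proof.
move=> sb; have sb' : same d c by rewrite same_blockC.
have : \sum_(q < s) (b q c.1 c.2 - b q d.1 d.2) ^+ 2 = 0.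
  have -> : \sum_(q < s) (b q c.1 c.2 - b q d.1 d.2) ^+ 2
      = gram c c - gram c d *+ 2 + gram d d.
    rewrite /gram -sumrMnl -sumrB -big_split; apply: eq_bigr => q _ /=; ring.
  rewrite !gram_diag (gram_same sb) (same_block_occupied sb) (same_block_occupied sb').
  by rewrite mulr1n; lra.
move/eqP; rewrite psumr_eq0 => [|q _]; last exact: sqr_ge0.
move=> /allP/(_ p (mem_index_enum p)); rewrite /= expf_eq0 /= subr_eq0.
by move/eqP.
Qed.

(** In a rectangle of occupied cells, a half (i, j) of a 2-edge can be traded for its
    mate (p, q), which has the same coefficient vector.  If the rectangle
    of (p, q) and (k, l) is occupied too, then (k, l) is the centre of a star over
    the 2-edge; if it is not, [gram_open] applies, and if it degenerates, the
    two cells share a row or a column. *)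
Lemma gram_closed i j k l : i != k -> j != l ->
  occ (i, j) -> occ (k, l) -> occ (i, l) -> occ (k, j) -> (i, j) \notin E1 ->
  gram (i, j) (k, l) = 0.
Proof.
move=> ik jl ij kl il kj /(occupied_two_edge augG ij)[[p q] ij_pq sb].
have -> : gram (i, j) (k, l) = gram (p, q) (k, l).
  by apply: eq_bigr => r _; rewrite (coeff_same r sb).
have not_kl : (p, q) != (k, l).
  apply: contraL sb => /eqP->; apply/negP => /(open_diagonal augG freeG ik jl).
  by rewrite il kj.
have Nsame : same (p, q) (k, l) = false.
  apply/negbTE/negP => sb'; have : same (i, j) (k, l).
    have /exists_inP[e eB /andP[ije pqe]] := sb.
    have /exists_inP[f fB /andP[pqf klf]] := sb'.
    apply/exists_inP; exists e => //; rewrite ije.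
    by rewrite (block_unique augG eB fB pqe pqf).
  by move/(open_diagonal augG freeG ik jl); rewrite il kj.
have [pk|pk] := eqVneq p k; first by subst p; rewrite gram_row Nsame.
have [ql|ql] := eqVneq q l; first by subst q; rewrite gram_col Nsame.
rewrite gram_open ?Nsame //; apply/negP => /andP[pl kq].
have kip : k \notin [:: i; p] by rewrite !inE negb_or ![k == _]eq_sym ik pk.
have ljq : l \notin [:: j; q] by rewrite !inE negb_or ![l == _]eq_sym jl ql.
by have := open_star augG freeG sb ij_pq kip ljq; rewrite /= kl kj kq il pl.
Qed.

(** The only case left by the previous lemmas is an occupied rectangle. Its
    corners are not all 1-edges.  If one of the two given corners is a half, the
    inner product vanishes directly; if a corner of the other diagonal is one,
    that diagonal vanishes, and with it, by [gram_cross], the given one. *)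
Lemma gramE c d : gram c d = (same c d)%:R.
Proof.
have [sb|sb] := boolP (same c d); first exact: gram_same.
case: c d sb => i j [k l] sb.
have [ik|ik] := eqVneq i k; first by subst k; rewrite gram_row (negPf sb).
have [jl|jl] := eqVneq j l; first by subst l; rewrite gram_col (negPf sb).
have [ij|/gram_unoccupied->//] := boolP (occ (i, j)).
have [kl|/gram_unoccupied] := boolP (occ (k, l)); last by rewrite gramC => ->.
have [/andP[il kj]|/gram_open->] := boolP (occ (i, l) && occ (k, j)); last first.
  by rewrite (negPf sb).
have ki : k != i by rewrite eq_sym.
have lj : l != j by rewrite eq_sym.
have cross0 : gram (i, l) (k, j) = 0 -> gram (i, j) (k, l) = 0.
  move=> g0; have := gram_cross i j k l; rewrite g0 (negPf sb).
  rewrite (_ : same _ _ = false); first by rewrite !addr0.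
  by apply/negbTE/negP => /(open_diagonal augG freeG ik lj); rewrite ij kl.
case/or4P: (no_one_edge_C4 freeG ik jl) => NE1.
- exact: gram_closed.
- by rewrite gramC; apply: gram_closed.
- by apply: cross0; apply: gram_closed.
by apply: cross0; rewrite gramC; apply: gram_closed.
Qed.

(** One cell in each block gives an orthonormal family in R^s. *)
Lemma card_blocks_le : (#|blocks E1 E2| <= s)%N.
Proof.
have /choice[rep repP] : forall x : 'I_#|blocks E1 E2|, exists c, c \in enum_val x.
  move=> x; have := enum_valP x; set e := enum_val x => /setUP[/imsetP[c _ ->]|eE2].
    by exists c; rewrite inE.
  by apply/card_gt0P; rewrite (card_two_edge augG eE2).
pose B : 'M[R]_(#|blocks E1 E2|, s) := \matrix_(x, p) b p (rep x).1 (rep x).2.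
apply: (@mulmx1_min _ _ _ B B^T); apply/matrixP => x y; rewrite !mxE.
under eq_bigr => p _ do rewrite !mxE.
rewrite -/(gram (rep x) (rep y)) gramE; congr (_%:R); congr nat_of_bool.
apply/exists_inP/eqP => [[e eB /andP[xe ye]]|<-].
  apply: enum_val_inj.
  by rewrite (block_unique augG (enum_valP x) eB (repP x) xe)
             (block_unique augG (enum_valP y) eB (repP y) ye).
by exists (enum_val x); rewrite ?enum_valP // repP.
Qed.

End GramMatrix.

Lemma block_poly_sos (R : realType) (m n : nat) (E1 : {set 'I_m * 'I_n})
    (E2 : {set {set 'I_m * 'I_n}}) :
  is_sos (block_poly R E1 E2).
Proof.
pose b (x : 'I_#|blocks E1 E2|) i j : R := ((i, j) \in enum_val x)%:R.
exists #|blocks E1 E2|; exists (fun x => bilinear_form (b x)); split=> [x|].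
  by exists (b x).
by rewrite /block_poly big_enum_val.
Qed.

Lemma limited_zarankiewicz_le_BSR (R : realType) (m n : nat) :
  (limited_zarankiewicz m n <= BSR R m n)%N.
Proof.
apply/bigmax_leqP => -[E1 E2] /= /andP[augG freeG].
have sosP := block_poly_sos R E1 E2.
apply: leq_trans (sos_rank_le_BSR sosP); rewrite -(card_blocks augG).
have [[f [/choice[b fE] PE]] _] := sos_rankP sosP.
apply: (card_blocks_le augG freeG (b := b)); apply: (etrans PE).
by apply: eq_bigr => p _; rewrite fE.
Qed.

(** * The bounds for 4t columns *)

Lemma mul2_bin2 (n : nat) : (2 * 'C(n, 2) = n * n.-1)%N.
Proof. by rewrite mulnC -[in LHS]/(2`!) bin_ffact ffactnS ffactn1. Qed.

Unset Implicit Arguments.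
Set Strict Implicit.
Local Open Scope classical_set_scope.
Local Open Scope ring_scope.

Theorem theorem3p1 (R : realType) :
  (forall t : nat, (1 <= t)%N ->
    (2 * 'C(4 * t, 2) + (4 * t ^ 2 - 2 * t)
       <= limited_zarankiewicz 'C(4 * t, 2) (4 * t))%N
    /\
    (2 * 'C(4 * t, 2) + (4 * t ^ 2 - 2 * t)
       <= BSR R 'C(4 * t, 2) (4 * t))%N)
  /\
  (\forall t \near \oo,
    let zL : R := (limited_zarankiewicz 'C(4 * t, 2) (4 * t))%:R in
    let z : R := (zarankiewicz 'C(4 * t, 2) (4 * t))%:R in
    (4 * t%:R ^+ 2 - 2 * t%:R) / (16 * t%:R ^+ 2 - 4 * t%:R) <= (zL - z) / z
    /\
    (4 * t%:R ^+ 2 - 2 * t%:R) / (16 * t%:R ^+ 2 - 4 * t%:R)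
      = (2 * t%:R - 1) / (2 * (4 * t%:R - 1)) :> R)
  /\
  ((2 * t%:R - 1) / (2 * (4 * t%:R - 1)) : R) @[t --> \oo] --> (1 / 4 : R).
Proof.
have four t : (4 * t = 2 * t * 2)%N by lia.
have bin2t t : (2 * 'C(2 * t, 2) = 4 * t ^ 2 - 2 * t)%N by rewrite mul2_bin2; nia.
have zL_ge t : (1 <= t)%N -> (2 * 'C(4 * t, 2) + (4 * t ^ 2 - 2 * t)
    <= limited_zarankiewicz 'C(4 * t, 2) (4 * t))%N.
  by move=> t1; rewrite -bin2t four limited_zarankiewicz_ge //; lia.
have t_ge1 t : (1 <= t)%N -> 1 <= t%:R :> R by rewrite ler1n.
split=> [t t1|].
  by split; [exact: zL_ge | exact: leq_trans (zL_ge t t1) (limited_zarankiewicz_le_BSR _ _ _)].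
split.
  exists 1%N => // t /= t1; have {}t_ge1 := t_ge1 t t1; split; last first.
    by field; rewrite !gt_eqF //=; nra.
  have zE : (zarankiewicz 'C(4 * t, 2) (4 * t))%:R = 16 * t%:R ^+ 2 - 4 * t%:R :> R.
    rewrite four zarankiewicz_bin2; last by lia.
    rewrite mul2_bin2 (_ : _ * _ = 16 * t ^ 2 - 4 * t)%N; last by nia.
    rewrite natrB; last by nia.
    by rewrite !natrM expr2.
  rewrite zE ler_pM2r; last by rewrite invr_gt0; nra.
  rewrite -zE lerBrDl.
  have -> : 4 * t%:R ^+ 2 - 2 * t%:R = (4 * t ^ 2 - 2 * t)%:R :> R.
    by rewrite natrB; [rewrite !natrM expr2 | nia].
  rewrite -natrD ler_nat; apply: leq_trans (zL_ge t t1).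
  by rewrite four zarankiewicz_bin2 //; lia.
(* Shifting t by one allows dividing numerator and denominator by t. *)
rewrite -cvg_shiftS.
have -> : (fun t => (2 * t.+1%:R - 1) / (2 * (4 * t.+1%:R - 1)) : R)
    = (fun t => (2 - harmonic t) / (2 * (4 - harmonic t))).
  have rescale (u : R) : 1 <= u -> (2 * u - 1) / (2 * (4 * u - 1))
      = (2 - u^-1) / (2 * (4 - u^-1)).
    by move=> u1; field; rewrite !gt_eqF //=; lra.
  by apply/funext => t; apply: rescale; rewrite ler1n.
have -> : 1 / 4 = (2 - 0) / (2 * (4 - 0)) :> R by field.
have cvgB0 (a : R) : a - harmonic t @[t --> \oo] --> a - 0.
  by apply: cvgB; [exact: cvg_cst | exact: cvg_harmonic].
apply: cvgM; first exact: cvgB0.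
apply: cvgV; last by apply: cvgM; [exact: cvg_cst | exact: cvgB0].
by rewrite subr0 mulf_neq0 // pnatr_eq0.
Qed.
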